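(* Let $d\ge 1$ be an integer and let $G$ be a finite, connected, $d$-regular simple graph that is not complete. Then \[\min_{v,r}\delta(\mathcal{L}_r(v))\leq\left\lfloor 2d/3\right\rfloor-1,\] where the minimum is over all vertices $v$ of $G$ and all integers $r\ge 1$ with $\mathcal{S}_r(v)\neq\varnothing$. Moreover, for every $d\equiv 2\pmod 3$ there exists a finite, connected, non-complete $d$-regular graph for which equality holds.
   Context: For a graph $G$, a vertex $v$ and an integer $r>0$, the sphere $\mathcal{S}_r(v)=\{w\in V(G): d(v,w)=r\}$ is the set of vertices at graph distance exactly $r$ from $v$. If $\mathcal{S}_r(v)\neq\varnothing$, the $r$-link graph of $v$ is the induced subgraph $\mathcal{L}_r(v)=G[\mathcal{S}_r(v)]$. $\delta(H)$ denotes the minimum degree of a graph $H$. *)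

(* Defs.v *)
From HB Require Import structures.
From mathcomp Require Import all_boot all_order all_algebra.

Set Implicit Arguments.
Unset Strict Implicit.
Unset Printing Implicit Defensive.

Record sgraph := SGraph {
  vertex :> finType;
  adj : rel vertex;
  adj_sym : symmetric adj;
  adj_irrefl : irreflexive adj
}.

Section Graph.
Variable G : sgraph.

Definition degree (v : G) : nat := #|[set w : G | adj v w]|.

Definition regular (d : nat) : Prop := forall v : G, degree v = d.

Definition connected : Prop := forall v w : G, connect (@adj G) v w.

Definition complete : Prop := forall v w : G, v != w -> adj v w.

(* Every degree is below #|G|, so the default value #|G| is only reached on
   the graph without vertices. *)
Definition min_degree : nat := \big[minn/#|G|]_(v : G) degree v.

Definition walk (n : nat) (v w : G) : bool :=
  [exists p : n.-tuple G, path (@adj G) v p && (last v p == w)].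

(* A shortest walk has length below #|G|; the default value #|G| stands for
   infinite distance. *)
Definition dist (v w : G) : nat := \big[minn/#|G|]_(n < #|G| | walk n v w) n.

Definition sphere (r : nat) (v : G) : {set G} :=
  [set w | connect (@adj G) v w && (dist v w == r)].

Section Induced.
Variable A : {set G}.

Definition induced_adj : rel {x : G | x \in A} :=
  fun x y => adj (val x) (val y).

Lemma induced_adj_sym : symmetric induced_adj.
Proof. by move=> x y; apply: adj_sym. Qed.

Lemma induced_adj_irrefl : irreflexive induced_adj.
Proof. by move=> x; apply: adj_irrefl. Qed.

Definition induced : sgraph := SGraph induced_adj_sym induced_adj_irrefl.
End Induced.

Definition link (r : nat) (v : G) : sgraph := induced (sphere r v).
End Graph.

Definition link_min_degree (G : sgraph) (n : nat) : Prop :=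
  exists (v : G) (r : nat),
    [/\ 0 < r, sphere r v != set0 & n = min_degree (link r v)].

Definition is_minimum (P : nat -> Prop) (m : nat) : Prop :=
  P m /\ forall n, P n -> m <= n.

(* Main.v *)
Require Import Defs.
From mathcomp Require Import all_boot all_order all_algebra.
From mathcomp Require Import zify.

Set Implicit Arguments.
Unset Strict Implicit.
Unset Printing Implicit Defensive.

(** Upper bound: since the graph is connected and not complete, it contains an
    induced path v - u - w.  If all links had minimum degree at least
    k = floor(2d/3), then counting the neighbours of w and of u layer by layer
    around v leaves w at most d - k neighbours in the first sphere and u at most
    d - k - 1 in the second.  The common neighbours of u and w lie in these two
    sets and avoid u and w, whence k <= 2d - 2k - 3, contradicting the choice
    of k.

    Sharpness: for d = 3t + 2, replace every vertex of the 5-cycle by a clique on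
    t + 1 vertices.  The 5-cycle has diameter 2 and its two vertices at distance
    2 from a given one are adjacent, so the second links have minimum degree
    2t + 1, and the first links 2t. *)

Lemma bigminn_le (I : finType) (P : pred I) (F : I -> nat) x i :
  P i -> \big[minn/x]_(j | P j) F j <= F i.
Proof. by rewrite -minEnat -leEnat; apply: Order.TotalTheory.bigmin_le_cond. Qed.

Lemma bigminn_le_id (I : finType) (P : pred I) (F : I -> nat) x :
  \big[minn/x]_(j | P j) F j <= x.
Proof. by rewrite -minEnat -leEnat; apply: Order.TotalTheory.bigmin_le_id. Qed.

(** * Walks, distances and spheres of small radius *)

Section Distance.
Variable G : sgraph.
Implicit Types u v w : G.

Lemma walkP n v w :
  reflect (exists p, [/\ path (@adj G) v p, last v p = w & size p = n])
          (walk n v w).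
Proof.
apply: (iffP existsP) => [[p /andP[vp /eqP pw]]|[p [vp pw /eqP sp]]].
  by exists p; rewrite size_tuple.
by exists (Tuple sp); rewrite /= vp pw eqxx.
Qed.

Lemma walk0 v w : walk 0 v w = (v == w).
Proof.
apply/walkP/eqP => [[p [_ + /size0nil p0]]|<-]; first by rewrite p0.
by exists [::].
Qed.

Lemma walk1 v w : walk 1 v w = adj v w.
Proof.
apply/walkP/idP => [[[|u [|x s]] []] //= /andP[vu _] <-|vw] //.
by exists [:: w]; rewrite /= vw.
Qed.

Lemma walk2 v w : walk 2 v w = [exists u, adj v u && adj u w].
Proof.
apply/walkP/existsP => [[[|u [|x [|y s]]] []] //= /and3P[vu ux _] <-|].
  by exists u; rewrite vu.
by case=> u /andP[vu uw]; exists [:: u; w]; rewrite /= vu uw.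
Qed.

Lemma walk_connect n v w : walk n v w -> connect (@adj G) v w.
Proof. by case/walkP=> p [vp pw _]; apply/connectP; exists p. Qed.

Lemma dist_le n v w : walk n v w -> dist v w <= n.
Proof.
move=> vw; have [ltn|len] := ltnP n #|G|.
  exact: (@bigminn_le _ _ _ _ (Ordinal ltn)).
(* Walks this long are not in the range of the minimum; its default value [#|G|] bounds it
   instead. *)
by apply: leq_trans len; apply: bigminn_le_id.
Qed.

(** A repetition-free path has fewer than [#|G|] edges, so the minimum lies below its default value
    and is attained by a walk. *)
Lemma walk_dist v w : connect (@adj G) v w -> walk (dist v w) v w.
Proof.
case/connectP=> p0 /shortenP[p vp up _] pw.
have ltp : size p < #|G| by rewrite -[_.+1]/(size (v :: p)) -(card_uniqP up) max_card.
have vw : walk (size p) v w by apply/walkP; exists p.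
suff [/eqP d|//] : dist v w = #|G| \/ walk (dist v w) v w.
  by move: (dist_le vw); rewrite (eqP d) leqNgt ltp.
rewrite /dist; apply: (big_ind (fun n => n = #|G| \/ walk n v w)) => [|x y|i]; auto.
by rewrite /minn; case: ifP.
Qed.

Lemma in_sphere0 v w : (w \in sphere 0 v) = (v == w).
Proof.
rewrite inE; apply/andP/idP => [[/walk_dist + /eqP d0]|].
  by rewrite d0 walk0.
rewrite -walk0 => vw; split; first exact: walk_connect vw.
by rewrite -leqn0 dist_le.
Qed.

Lemma in_sphere_gt0 r v w : 0 < r -> w \in sphere r v -> v != w.
Proof.
rewrite -in_sphere0 !inE => r0 /andP[-> /eqP->] /=.
by rewrite -lt0n.
Qed.

Lemma in_sphere1 v w : (w \in sphere 1 v) = adj v w.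
Proof.
apply/idP/idP => [|vw]; first by rewrite inE => /andP[/walk_dist + /eqP d1]; rewrite d1 walk1.
rewrite -walk1 in vw; rewrite inE (walk_connect vw) /= eqn_leq dist_le //=.
have := in_sphere0 v w; rewrite inE (walk_connect vw) /= lt0n => ->.
by apply: contraTneq vw => ->; rewrite walk1 adj_irrefl.
Qed.

(** A walk of length 2 bounds the distance above, and excluding distances 0 and 1 then leaves only
    2. The counting arguments below use this local description instead of [dist]. *)
Lemma in_sphere2 v w :
  (w \in sphere 2 v) = [&& v != w, ~~ adj v w & [exists u, adj v u && adj u w]].
Proof.
rewrite -walk2 -in_sphere0 -in_sphere1 !inE.
case C: (connect _ v w) => /=; last first.
  by apply/esym/negbTE; apply: contraFN C => /walk_connect.
apply/eqP/and3P => [d2|[d0 d1 /dist_le]].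
  by move: (walk_dist C); rewrite d2.
by case: (dist v w) d0 d1 => [|[|[|]]].
Qed.

(** Without an induced path of length 2 from [v], being equal or adjacent to [v] propagates along
    any path starting at [v]; connectedness then makes the graph complete. *)
Lemma exists_induced_path :
  connected G -> ~ complete G ->
  exists v u w, [/\ v != w, ~~ adj v w, adj v u & adj u w].
Proof.
move=> conG ncG.
have [/existsP[v /existsP[u /existsP[w /and4P[]]]]|no] :=
  boolP [exists v : G, exists u, exists w,
           [&& v != w, ~~ adj v w, adj v u & adj u w]]; first by exists v, u, w.
case: ncG => v w; rewrite eq_sym.
have /connectP[p vp ->] := conG v w; elim/last_ind: p vp {w} => [|p x IH].
  by rewrite eqxx.
rewrite rcons_path last_rcons => /andP[/IH {}IH px] xv.
have [lv|/IH vl] := eqVneq (last v p) v; first by rewrite -lv.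
apply: contraNT no => nvx; apply/existsP; exists v.
by apply/existsP; exists (last v p); apply/existsP; exists x; rewrite eq_sym xv nvx vl.
Qed.

End Distance.

(** * Minimum degrees of links, counted inside the ambient graph *)

Section Links.
Variable G : sgraph.

Definition neighbors (v : G) : {set G} := [set w | adj v w].

Lemma degree_induced (A : {set G}) (x : induced A) :
  degree x = #|A :&: neighbors (val x)|.
Proof.
rewrite /degree -(card_imset _ val_inj); apply: eq_card => y.
apply/imsetP/setIP => [[z + ->]|[yA]].
  by rewrite !inE => xz; split=> //; apply: valP.
by rewrite inE => xy; exists (Sub y yA : induced A); rewrite // inE.
Qed.

Lemma min_degree_le (v : G) : min_degree G <= degree v.
Proof. exact: bigminn_le. Qed.

Lemma le_min_degree n (v0 : G) : (forall v : G, n <= degree v) -> n <= min_degree G.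
Proof.
move=> le_n; rewrite /min_degree; apply: (big_ind (fun m => n <= m)) => //.
  (* The default value [#|G|] of the minimum is itself at least [degree v0]. *)
  by apply: leq_trans (le_n v0) _; apply: max_card.
by move=> x y nx ny; rewrite leq_min nx.
Qed.

End Links.

Lemma link_min_degree_le (G : sgraph) r (v w : G) :
  w \in sphere r v -> min_degree (link r v) <= #|sphere r v :&: neighbors w|.
Proof. by move=> rw; rewrite -(degree_induced (Sub w rw)) min_degree_le. Qed.

Lemma le_link_min_degree (G : sgraph) n r (v : G) :
  sphere r v != set0 ->
  (forall w, w \in sphere r v -> n <= #|sphere r v :&: neighbors w|) ->
  n <= min_degree (link r v).
Proof.
case/set0Pn=> w rw le_n; apply: (@le_min_degree (link r v) n (Sub w rw)) => x.
by rewrite degree_induced le_n ?(valP x).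
Qed.

(** A nonempty sphere of positive radius has as radius the distance between two distinct vertices,
    so minimizing over the finitely many such pairs covers all radii. The pair [(v, w)] makes the
    range nonempty. *)
Lemma link_min_degree_minimum (G : sgraph) (v w : G) :
  connected G -> v != w -> exists m, is_minimum (link_min_degree G) m.
Proof.
move=> conG vw.
pose F (p : G * G) := min_degree (link (dist p.1 p.2) p.1).
case: (@arg_minnP _ (v, w) (fun p => p.1 != p.2) F vw) => -[x y] /= xy min_xy.
exists (F (x, y)); split=> [|n [x' [r [r0 /set0Pn[y' ry']] ->]]].
  exists x, (dist x y); split=> //; last by apply/set0Pn; exists y; rewrite inE conG /=.
  have := in_sphere0 x y; rewrite inE conG lt0n /= => ->; exact: xy.
have := min_xy (x', y') (in_sphere_gt0 r0 ry'); rewrite /F /=.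
by move: ry'; rewrite inE => /andP[_ /eqP->].
Qed.

(** * The upper bound, by counting along an induced path *)

Lemma link_min_degree_upper (G : sgraph) d m :
  connected G -> regular G d -> ~ complete G ->
  (forall n, link_min_degree G n -> m <= n) -> m < 2 * d %/ 3.
Proof.
move=> conG regG ncG min_m; rewrite ltnNge; apply/negP => le_m.
have [v [u [w [vw nvw vu uw]]]] := exists_induced_path conG ncG.
have link_ge r (x y : G) : 0 < r -> y \in sphere r x ->
    2 * d %/ 3 <= #|sphere r x :&: neighbors y|.
  move=> r0 ry; apply: leq_trans (link_min_degree_le ry).
  apply: leq_trans le_m (min_m _ _); exists x, r; split=> //.
  by apply/set0Pn; exists y.
have w2 : w \in sphere 2 v.
  by rewrite in_sphere2 vw nvw; apply/existsP; exists u; rewrite vu.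
have vu1 : u \in sphere 1 v by rewrite in_sphere1.
have uw1 : w \in sphere 1 u by rewrite in_sphere1.
have := link_ge 1 v u isT vu1; have := link_ge 1 u w isT uw1.
have := link_ge 2 v w isT w2.
have dw : #|sphere 1 v :&: neighbors w| + #|sphere 2 v :&: neighbors w| <= d.
  rewrite -[leqRHS](regG w) -cardsUI [X in _ + X]eq_card0 ?addn0.
    by apply/subset_leq_card/subsetP=> x; rewrite !inE => /orP[]/andP[].
  move=> x; rewrite in_setI [x \in _ :&: _]in_setI [X in _ && X]in_setI.
  by rewrite in_sphere1 in_sphere2; case: (adj v x); rewrite ?andbF.
(* The successor accounts for [v], a neighbour of [u] lying in neither sphere. *)
have du : (#|sphere 1 v :&: neighbors u| + #|sphere 2 v :&: neighbors u|).+1 <= d.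
  rewrite -[leqRHS](regG u) -cardsUI [X in _ + X]eq_card0 ?addn0.
    rewrite /degree [leqRHS](cardsD1 v) inE adj_sym vu add1n ltnS.
    apply/subset_leq_card/subsetP=> x; rewrite in_setU !in_setI in_sphere1 in_sphere2.
    rewrite !inE eq_sym => /orP[/andP[vx ->]|/andP[/and3P[-> _ _] -> //]].
    by rewrite andbT; apply: contraTneq vx => ->; rewrite adj_irrefl.
  move=> x; rewrite in_setI [x \in _ :&: _]in_setI [X in _ && X]in_setI.
  by rewrite in_sphere1 in_sphere2; case: (adj v x); rewrite ?andbF.
(* A common neighbour [x] of [u] and [w] is either adjacent to [v] or at distance 2 from it through
   [u]; in the latter case [x] is not [v], since [v] and [w] are not adjacent. *)
have : #|sphere 1 u :&: neighbors w| <=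
    #|(sphere 1 v :&: neighbors w) :\ u| + #|(sphere 2 v :&: neighbors u) :\ w|.
  rewrite -cardsUI; apply: leq_trans (leq_addr _ _).
  apply/subset_leq_card/subsetP=> x; rewrite in_setU !in_setD1 !in_setI.
  rewrite !in_sphere1 in_sphere2 !inE => /andP[ux wx].
  have -> : x != u by apply: contraTneq ux => ->; rewrite adj_irrefl.
  have -> : x != w by apply: contraTneq wx => ->; rewrite adj_irrefl.
  rewrite ux wx; case vx: (adj v x) => //=; rewrite andbT.
  rewrite (contraNneq _ nvw) /=; last by move=> ->; rewrite adj_sym.
  by apply/existsP; exists u; rewrite vu.
(* Each removal costs exactly one vertex, leaving at most [d - k - 1] and [d - k - 2], where
   [k = 2 * d %/ 3]. Hence [3 * k <= 2 * d - 3], whereas floor division gives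
   [3 * k >= 2 * d - 2]. *)
have := cardsD1 u (sphere 1 v :&: neighbors w).
have := cardsD1 w (sphere 2 v :&: neighbors u).
rewrite !in_setI w2 vu1 !inE uw adj_sym uw /=.
lia.
Qed.

(** * Sharpness: the clique blowup of the 5-cycle *)

Section PentagonBlowup.

(** Loops are included so that distinct vertices over the same index become adjacent in the
    blowup. *)
Definition pentagon (i j : 'I_5) : bool :=
  [|| i == j, i.+1 %% 5 == j | j.+1 %% 5 == i].

Lemma pentagon_sym : symmetric pentagon.
Proof. by move=> i j; rewrite /pentagon eq_sym; congr orb; rewrite orbC. Qed.

Lemma card_pentagon (i : 'I_5) : #|[set k | pentagon i k]| = 3.
Proof.
rewrite cardsE -sum1_card big_mkcond /= !big_ord_recl big_ord0 /pentagon /in_mem /= /eq_op /=.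
by case: i => [[|[|[|[|[|]]]]]].
Qed.

(** If [i] and [j] differ, both of them count; if they agree, the whole closed neighbourhood
    does. *)
Lemma card_pentagonI (i j : 'I_5) :
  pentagon i j -> 2 <= #|[set k | pentagon i k && pentagon j k]|.
Proof.
rewrite cardsE -sum1_card big_mkcond /= !big_ord_recl big_ord0 /pentagon /in_mem /= /eq_op /=.
by case: i => [[|[|[|[|[|]]]]]] //; case: j => [[|[|[|[|[|]]]]]].
Qed.

(** The two indices not related to [i] are [j] and a cyclic neighbour of [j]. *)
Lemma card_pentagonD (i j : 'I_5) :
  ~~ pentagon i j -> 2 <= #|[set k | ~~ pentagon i k && pentagon j k]|.
Proof.
rewrite cardsE -sum1_card big_mkcond /= !big_ord_recl big_ord0 /pentagon /in_mem /= /eq_op /=.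
by case: i => [[|[|[|[|[|]]]]]] //; case: j => [[|[|[|[|[|]]]]]].
Qed.

Lemma pentagon_diameter (i j : 'I_5) : exists k, pentagon i k && pentagon k j.
Proof.
apply/existsP; apply: contraT; rewrite negb_exists => /forallP no.
have := no (inord 0); have := no (inord 1); have := no (inord 2).
have := no (inord 3); have := no (inord 4); rewrite /pentagon /eq_op /= !inordK //.
by case: i {no} => [[|[|[|[|[|]]]]]] //; case: j => [[|[|[|[|[|]]]]]].
Qed.

Variable t : nat.

Definition blowup_adj : rel ('I_5 * 'I_t.+1) :=
  fun p q => (p != q) && pentagon p.1 q.1.

Lemma blowup_adj_sym : symmetric blowup_adj.
Proof. by move=> p q; rewrite /blowup_adj eq_sym pentagon_sym. Qed.

Lemma blowup_adj_irrefl : irreflexive blowup_adj.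
Proof. by move=> p; rewrite /blowup_adj eqxx. Qed.

Definition blowup : sgraph := SGraph blowup_adj_sym blowup_adj_irrefl.

Implicit Types p q : blowup.

Lemma card_blowup_layers (A : {set 'I_5}) : #|setX A [set: 'I_t.+1]| = #|A| * t.+1.
Proof. by rewrite cardsX cardsT card_ord. Qed.

(** A closed neighbourhood consists of three cliques of size [t.+1]; removing the vertex itself
    leaves [3 * t.+1 - 1]. *)
Lemma blowup_regular : regular blowup (3 * t + 2).
Proof.
move=> p; set X : {set blowup} := setX [set k | pentagon p.1 k] [set: 'I_t.+1].
have cX : #|X| = 3 * t.+1 by rewrite card_blowup_layers card_pentagon.
have pX : p \in X by rewrite !inE /pentagon eqxx.
suff -> : degree p = #|X :\ p| by have := cardsD1 p X; rewrite pX; lia.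
by apply: eq_card => q; rewrite !inE andbT /= /blowup_adj eq_sym.
Qed.

Lemma blowup_sphere2 p q : ~~ pentagon p.1 q.1 -> q \in sphere 2 p.
Proof.
move=> npq; rewrite in_sphere2 /= /blowup_adj (negbTE npq) andbF /=.
apply/andP; split; first by apply: contraNneq npq => ->; rewrite /pentagon eqxx.
have [k /andP[pk kq]] := pentagon_diameter p.1 q.1.
(* Any second coordinate would do: if the middle vertex were [p] or [q], then [p.1] and [q.1] would
   be related. *)
apply/existsP; exists (k, ord0); rewrite pk kq !andbT.
apply/andP; split; apply: contraNneq npq => e; first by rewrite e.
by rewrite -e.
Qed.

Lemma blowup_connected : connected blowup.
Proof.
move=> p q; have [->|pq] := eqVneq p q; first exact: connect0.
have [ad|/blowup_sphere2] := boolP (pentagon p.1 q.1).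
  by apply: connect1; rewrite /= /blowup_adj pq.
by rewrite inE => /andP[].
Qed.

Lemma blowup_not_complete : ~ complete blowup.
Proof.
by move/(_ (inord 0, ord0) (inord 2, ord0)); rewrite /= /blowup_adj /pentagon /= /eq_op /=
  /eq_op /= !inordK // => /(_ isT).
Qed.

Lemma blowup_link_ge r p q : 0 < r -> q \in sphere r p ->
  2 * t <= #|sphere r p :&: neighbors q|.
Proof.
move=> r0 rq; have pq := in_sphere_gt0 r0 rq.
have [ad|nad] := boolP (pentagon p.1 q.1).
  have q1 : q \in sphere 1 p by rewrite in_sphere1 /= /blowup_adj pq.
  have {rq r0} -> : r = 1.
    by move: rq q1; rewrite !inE => /andP[_ /eqP->] /andP[_ /eqP].
  (* At least two full cliques, from which only [p] and [q] must be discarded: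
     [2 * t.+1 - 2 = 2 * t]. *)
  set X : {set blowup} := setX [set k | pentagon p.1 k && pentagon q.1 k] [set: 'I_t.+1].
  have cX : 2 * t.+1 <= #|X| by rewrite card_blowup_layers leq_mul2r card_pentagonI.
  have : #|X :\ p :\ q| <= #|sphere 1 p :&: neighbors q|.
    apply/subset_leq_card/subsetP=> x; rewrite in_setI in_sphere1 !inE /= andbT /blowup_adj.
    by rewrite (eq_sym p) (eq_sym q) => /and4P[-> -> -> ->].
  have := cardsD1 p X; have := cardsD1 q (X :\ p); lia.
have q2 := blowup_sphere2 nad.
have {rq r0} -> : r = 2.
  by move: rq q2; rewrite !inE => /andP[_ /eqP->] /andP[_ /eqP].
(* Here only [q] is discarded, so the count is at least [2 * t + 1]. *)
set X : {set blowup} := setX [set k | ~~ pentagon p.1 k && pentagon q.1 k] [set: 'I_t.+1].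
have cX : 2 * t.+1 <= #|X| by rewrite card_blowup_layers leq_mul2r card_pentagonD.
have : #|X :\ q| <= #|sphere 2 p :&: neighbors q|.
  apply/subset_leq_card/subsetP=> x; rewrite in_setI in_setD1 inE [x.2 \in _]inE andbT.
  rewrite [x.1 \in _]inE => /and3P[xq /blowup_sphere2 -> qx].
  by rewrite inE /= /blowup_adj eq_sym xq.
have := cardsD1 q X; lia.
Qed.

End PentagonBlowup.

Theorem theorem1 :
  (forall (d : nat) (G : sgraph),
     1 <= d -> connected G -> regular G d -> ~ complete G ->
     exists m : nat, is_minimum (link_min_degree G) m /\
       (m%:Z <= (2 * d %/ 3)%N%:Z - 1)%R) /\
  (forall d : nat, d = 2 %[mod 3] ->
     exists G : sgraph,
       [/\ connected G, regular G d, ~ complete G &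
         exists m : nat, is_minimum (link_min_degree G) m /\
           (m%:Z = (2 * d %/ 3)%N%:Z - 1)%R]).
Proof.
(* Shared by both halves; the strict inequality in [nat] expresses the bound without truncated
   subtraction. *)
have minimum (G : sgraph) d : connected G -> regular G d -> ~ complete G ->
    exists2 m, is_minimum (link_min_degree G) m & m < 2 * d %/ 3.
  move=> conG regG ncG.
  have [v [_ [w [vw _ _ _]]]] := exists_induced_path conG ncG.
  have [m min_m] := link_min_degree_minimum conG vw.
  by exists m => //; apply: link_min_degree_upper ncG (proj2 min_m).
split=> [d G _ conG regG ncG|d d2].
  by have [m min_m lt_m] := minimum G d conG regG ncG; exists m; split=> //; lia.
have [t dt] : exists t, d = 3 * t + 2 by exists (d %/ 3); lia.
have conB := @blowup_connected t; have ncB := @blowup_not_complete t.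
have regB : regular (blowup t) d by rewrite dt; apply: blowup_regular.
exists (blowup t); split=> //.
have [m min_m lt_m] := minimum _ d conB regB ncB.
exists m; split=> //.
have [v [r [r0 r_n0 m_def]]] := proj1 min_m.
have : 2 * t <= m.
  by rewrite m_def; apply: le_link_min_degree => // w; apply: blowup_link_ge.
(* For [d = 3 * t + 2] the quotient [2 * d %/ 3] is [2 * t + 1], so the two bounds force
   [m = 2 * t]. *)
lia.
Qed.
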